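(* Let $L\in R[x][\partial]$ have order $r>0$, and let $\ell\in\mathbb{N}$ be such that $M_\ell(L)$ contains a generating set of the left ideal $\mathrm{cont}(L)$. Let $I_\ell$ be the $\ell$th coefficient ideal and $\mathbf{G}$ a reduced Gröbner basis of the ideal $I_\ell\subseteq R[x]$. Let $f\in\mathbf{G}$ be of lowest degree in $x$, and let $F\in\mathrm{cont}(L)$ with $\mathrm{lc}_\partial(F)=f$. Then $F$ is a completely desingularized operator for $L$.
   Context: $R$ is a principal ideal domain with quotient field $Q_R$; $\sigma$ is an $R$-automorphism of $R[x]$ with $\sigma(x)=\gamma x+\tau$ ($\gamma$ a unit), $\delta$ an $R$-linear $\sigma$-derivation with $\deg\delta(x)\le1$; $R[x][\partial]$ is the Ore algebra with $\partial p=\sigma(p)\partial+\delta(p)$, inside $Q_R(x)[\partial]$. $\mathrm{cont}(L)=Q_R(x)[\partial]L\cap R[x][\partial]$, $M_k(L)=\{P\in\mathrm{cont}(L):\deg_\partial P\le k\}$, $I_k=\{[\partial^k]P:P\in M_k(L)\}\cup\{0\}$ (coefficient of $\partial^k$). Gröbner bases of ideals in $R[x]$ are in the sense of Gröbner bases over a principal ideal domain (Becker–Weispfenning). Every nonzero polynomial in $R[x]$ is its content (in $R$) times a primitive polynomial. Removability and desingularized operators: for $p\in R[x]$ dividing $\mathrm{lc}_\partial(L)$, $p$ is removable from $L$ at order $k$ if there are $P\in Q_R(x)[\partial]$ of order $k$ and $w,v\in R[x]$, $\gcd(p,w)=1$, with $PL\in R[x][\partial]$ and $\sigma^{-k}(\mathrm{lc}_\partial(PL))=\frac{w}{vp}\mathrm{lc}_\partial(L)$;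 non-removable if removable at no order. If $\mathrm{lc}_\partial(L)=c\,p_1^{e_1}\cdots p_m^{e_m}$ ($c\in R$, $p_i$ irreducible pairwise coprime non-constant), $T\in R[x][\partial]$ of order $k$ is a desingularized operator for $L$ if $T\in\mathrm{cont}(L)$ and $\sigma^{r-k}(\mathrm{lc}_\partial(T))=\frac{a}{b\,p_1^{k_1}\cdots p_m^{k_m}}\mathrm{lc}_\partial(L)$ with $a,b\in R$, $b\ne0$, and $p_i^{d_i}$ non-removable from $L$ for all $d_i>k_i$. A desingularized operator $Q$ for $L$ is completely desingularized if the content of $\mathrm{lc}_\partial(Q)$ divides the content of the leading coefficient of every desingularized operator for $L$. *)

(* Defs.v *)
From HB Require Import structures.
From mathcomp Require Import all_boot all_order all_algebra fraction.
Set Implicit Arguments. Unset Strict Implicit. Unset Printing Implicit Defensive.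
Import GRing.Theory.
Local Open Scope ring_scope.

Notation "x %:F" := (@FracField.tofrac _ x).

Section Arith.
Variable T : idomainType.

Definition dvdr (a b : T) : Prop := exists c : T, b = c * a.

Definition coprimeR (a b : T) : Prop :=
  forall d : T, dvdr d a -> dvdr d b -> d \is a GRing.unit.

Definition irreducibleR (p : T) : Prop :=
  p != 0 /\ p \isn't a GRing.unit /\
  forall a b : T, p = a * b -> a \is a GRing.unit \/ b \is a GRing.unit.

Definition is_ideal (S : T -> Prop) : Prop :=
  S 0 /\ (forall a b, S a -> S b -> S (a - b)) /\ (forall c a, S a -> S (c * a)).

Definition PID : Prop :=
  forall S : T -> Prop, is_ideal S -> exists g : T, forall a, S a <-> dvdr g a.
End Arith.

Section PolyR.
Variable R : idomainType.

Definition is_content (c : R) (p : {poly R}) : Prop :=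
  (forall i, dvdr c p`_i) /\
  (forall d : R, (forall i, dvdr d p`_i) -> dvdr d c).

(* Strong Groebner basis of an ideal I of R[x] (R a PID, univariate case):
   G is a finite set of nonzero elements of I such that every nonzero h in I
   has its leading term divisible by the leading term of some g in G. *)
Definition GB (I : {poly R} -> Prop) (G : seq {poly R}) : Prop :=
  (forall g, g \in G -> g != 0 /\ I g) /\
  (forall h, I h -> h != 0 ->
     exists2 g, g \in G & (size g <= size h)%N /\ dvdr (lead_coef g) (lead_coef h)).

(* Reduced: no term of any g in G is (strongly) reducible by another element
   g' of G, i.e. no term  a x^k  of g with deg g' <= k and lc(g') | a. *)
Definition reduced_GB (I : {poly R} -> Prop) (G : seq {poly R}) : Prop :=
  GB I G /\ uniq G /\
  (forall g g', g \in G -> g' \in G -> g != g' ->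
     forall k, (size g' <= k.+1)%N -> g`_k != 0 -> ~ dvdr (lead_coef g') g`_k).
End PolyR.

Section Ore.
Variable R : idomainType.
Local Notation K := {fraction {poly R}}.
Variables (sigma sigmainv delta : {poly R} -> {poly R}).

Definition liftK (s : {poly R} -> {poly R}) (u : K) : K :=
  let x := repr u in (s \n_x)%:F / (s \d_x)%:F.

Definition deltaK (u : K) : K :=
  let x := repr u in ((delta \n_x)%:F - liftK sigma u * (delta \d_x)%:F) / (\d_x)%:F.

Definition sigZ (z : int) (u : K) : K :=
  match z with
  | Posz n => iter n (liftK sigma) u
  | Negz n => iter n.+1 (liftK sigmainv) u
  end.

(* operators in Q_R(x)[d] are coefficient lists: sum_i a_i d^i  ~  \sum a_i 'X^i *)
(* left multiplication by d :  d a = sigma(a) d + delta(a) *)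
Definition ore_dmul (B : {poly K}) : {poly K} :=
  map_poly (liftK sigma) B * 'X + map_poly deltaK B.

Definition ore_mul (A B : {poly K}) : {poly K} :=
  \sum_(i < size A) A`_i *: iter i ore_dmul B.

Definition emb (P : {poly {poly R}}) : {poly K} := map_poly (fun p => p%:F) P.

Definition ordr (P : {poly {poly R}}) : nat := (size P).-1.

Definition cont (L P : {poly {poly R}}) : Prop :=
  exists A : {poly K}, ore_mul A (emb L) = emb P.

Definition Mk (L : {poly {poly R}}) (k : nat) (P : {poly {poly R}}) : Prop :=
  cont L P /\ (size P <= k.+1)%N.

Definition Ik (L : {poly {poly R}}) (k : nat) (p : {poly R}) : Prop :=
  p = 0 \/ exists P, Mk L k P /\ P`_k = p.

Definition Mk_generates (L : {poly {poly R}}) (l : nat) : Prop :=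
  forall P, cont L P ->
    exists s : seq ({poly {poly R}} * {poly {poly R}}),
      (forall q, q \in s -> Mk L l q.2) /\
      emb P = \sum_(q <- s) ore_mul (emb q.1) (emb q.2).

Definition removable (p : {poly R}) (L : {poly {poly R}}) (k : nat) : Prop :=
  dvdr p (lead_coef L) /\
  exists (P : {poly K}) (w v : {poly R}) (Q : {poly {poly R}}),
    size P = k.+1 /\ coprimeR p w /\ v != 0 /\
    ore_mul P (emb L) = emb Q /\
    sigZ (- (k%:Z)) (lead_coef Q)%:F = w%:F / (v%:F * p%:F) * (lead_coef L)%:F.

Definition non_removable (p : {poly R}) (L : {poly {poly R}}) : Prop :=
  forall k, ~ removable p L k.

(* desingularized operator for L, w.r.t. the factorization
   lc(L) = c * prod_i ps_i ^ es_i  *)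
Definition desingularized (ps : seq {poly R}) (L T : {poly {poly R}}) : Prop :=
  cont L T /\ T != 0 /\
  exists (a b : R) (ks : seq nat),
    b != 0 /\ size ks = size ps /\
    sigZ ((ordr L)%:Z - (ordr T)%:Z) (lead_coef T)%:F =
      (a%:P)%:F / ((b%:P)%:F * (\prod_(i < size ps) ps`_i ^+ nth 0%N ks i)%:F)
        * (lead_coef L)%:F /\
    (forall i, (i < size ps)%N -> forall d, (nth 0%N ks i < d)%N ->
        non_removable (ps`_i ^+ d) L).

Definition completely_desingularized (ps : seq {poly R}) (L Q : {poly {poly R}}) : Prop :=
  desingularized ps L Q /\
  forall T, desingularized ps L T ->
    forall cQ cT : R, is_content cQ (lead_coef Q) -> is_content cT (lead_coef T) ->
      dvdr cQ cT.
End Ore.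

(* Main.v *)
(** Clearing denominators, P lies in cont(L) iff b P = A L for some nonzero b in
    R[x] and A in R[x][d].  The polynomials sigma^(-k)(h), where h is the
    coefficient of d^(k + r) of an operator of order at most k + r in cont(L),
    form an ideal J of R[x] containing lc(L).  Since M_l generates cont(L), a
    leading coefficient of order j + l >= l is sigma^j of an element of I_l, so
    that no nonzero element of J has degree below deg f.  Hence
    f' = sigma^(-k)(f), with ord F = k + r, divides every element of J up to a
    constant.  As each p_i is prime in R[x] (Gauss), f' is, up to constants,
    lc(L) / prod_i p_i^(k_i); p_i^d is then non-removable for d > k_i because
    f' divides J, and p_i^(k_i) is removed by F itself.  The latter bounds the
    degree of the leading coefficient of every desingularized T by deg f; it
    therefore corresponds to an element of I_l of minimal degree, and
    reducedness of the Groebner basis makes f divide all of these. *)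

Require Import Defs.
From HB Require Import structures.
From mathcomp Require Import all_boot all_order all_algebra fraction.
From mathcomp Require Import ring generic_quotient.
Set Implicit Arguments. Unset Strict Implicit. Unset Printing Implicit Defensive.
Import GRing.Theory.
Local Open Scope ring_scope.

(** * Divisibility and prime elements in an integral domain *)

Section Divisibility.
Variable T : idomainType.
Implicit Types a b c d p q : T.

Lemma dvdr_refl a : dvdr a a.
Proof. by exists 1; rewrite mul1r. Qed.

Lemma dvdr0 a : dvdr a 0.
Proof. by exists 0; rewrite mul0r. Qed.

Lemma dvdr_trans b a c : dvdr a b -> dvdr b c -> dvdr a c.
Proof. by move=> [x ->] [y ->]; exists (y * x); rewrite mulrA. Qed.

Lemma dvdrD d a b : dvdr d a -> dvdr d b -> dvdr d (a + b).
Proof. by move=> [x ->] [y ->]; exists (x + y); rewrite mulrDl. Qed.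

Lemma dvdrB d a b : dvdr d a -> dvdr d b -> dvdr d (a - b).
Proof. by move=> [x ->] [y ->]; exists (x - y); rewrite mulrBl. Qed.

Lemma dvdr_mull d c a : dvdr d a -> dvdr d (c * a).
Proof. by move=> [x ->]; exists (c * x); rewrite mulrA. Qed.

Lemma dvdr_mulr d c a : dvdr d a -> dvdr d (a * c).
Proof. by rewrite mulrC; apply: dvdr_mull. Qed.

Lemma dvdr_sum d (I : finType) (F : I -> T) (P : pred I) :
  (forall i, P i -> dvdr d (F i)) -> dvdr d (\sum_(i | P i) F i).
Proof.
move=> h; apply: (big_ind (@dvdr T d)) => //; [exact: dvdr0 | exact: dvdrD].
Qed.

Definition primeR p :=
  [/\ p != 0, p \isn't a GRing.unit
    & forall a b, dvdr p (a * b) -> dvdr p a \/ dvdr p b].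

Lemma primeR_exp p a n : primeR p -> dvdr p (a ^+ n) -> dvdr p a.
Proof.
move=> [_ pU pP]; elim: n => [|n IHn]; last by rewrite exprS => /pP[].
by move=> [c cE]; case/negP: pU; apply/unitrPr; exists c; rewrite mulrC -cE.
Qed.

Lemma primeR_prod p (I : finType) (F : I -> T) (P : pred I) : primeR p ->
  dvdr p (\prod_(i | P i) F i) -> exists2 i, P i & dvdr p (F i).
Proof.
move=> pP; apply: (big_ind (fun x => dvdr p x -> exists2 i, P i & dvdr p (F i))).
- move=> [c cE]; case: pP => _ /negP[]; apply/unitrPr; exists c.
  by rewrite mulrC -cE.
- by case: pP => _ _ pP a b ha hb /pP[].
- by move=> i Pi; exists i.
Qed.

End Divisibility.

(** * Gauss's lemma over a principal ideal domain *)

Section Gauss.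
Variable R : idomainType.
Implicit Types p s : {poly R}.

(** Primitivity in Bezout form: the coefficients generate the unit ideal, with [u] as
    certificate. *)
Definition unimodular p := exists u : nat -> R, \sum_(i < size p) u i * p`_i = 1.

Lemma dvdr_polyC_coef (a : R) s i : dvdr a%:P s -> dvdr a%:P (s`_i)%:P.
Proof.
by move=> [q ->]; exists (q`_i)%:P; rewrite coefMC polyCM.
Qed.

Lemma coef_dvdr_polyC (a : R) s : (forall i, dvdr a s`_i) -> dvdr a%:P s.
Proof.
move=> h; rewrite -[X in dvdr _ X]coefK poly_def; apply: dvdr_sum => i _.
rewrite -mul_polyC; apply: dvdr_mulr.
by have [c ->] := h i; exists c%:P; rewrite polyCM.
Qed.

(* McCoy's argument: a nonzero annihilator of [p] modulo [a] of minimal degree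
   is killed by every coefficient of [p], hence by 1. *)
Lemma unimodular_gauss (a : R) p s : unimodular p ->
  dvdr a%:P (p * s) -> dvdr a%:P s.
Proof.
move=> [u pu]; have [n le_s] := ubnP (size s).
elim: n s le_s => // n IHn s le_s aps.
(* Descending induction on [i], with [k] bounding the distance of [i] from [size p]. *)
suff H k i : (size p <= i + k)%N -> dvdr a%:P ((p`_i)%:P * s).
  rewrite -[s]mul1r -[1]/(1%:P) -pu rmorph_sum mulr_suml.
  apply: dvdr_sum => i _; rewrite rmorphM /= -mulrA.
  by apply: dvdr_mull; apply: (H (size p)); rewrite leq_addl.
elim: k i => [|k IHk] i le_p.
  by rewrite nth_default ?mul0r; [exact: dvdr0 | rewrite -[i]addn0].
have [s0|s0] := posnP (size s).
  by move/eqP: s0; rewrite size_poly_eq0 => /eqP->; rewrite mulr0; exact: dvdr0.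
set m := (size s).-1; have mS : size s = m.+1 by rewrite /m prednK.
(* In the coefficient of degree [i + m] of [p * s], terms with [j < i] vanish because [s] has degree
   [m], and those with [j > i] are divisible by [a] through [IHk]. *)
have top : dvdr a%:P (p`_i * s`_m)%:P.
  have := dvdr_polyC_coef (i + m) aps.
  have lt_i : (i < (i + m).+1)%N by rewrite ltnS leq_addr.
  rewrite coefM (bigD1 (Ordinal lt_i)) //= addKn rmorphD /= => hsum.
  rewrite -[X in dvdr _ X](addrK ((\sum_(j < (i + m).+1 | j != Ordinal lt_i)
    p`_j * s`_(i + m - j))%:P)).
  apply: dvdrB => //; rewrite rmorph_sum; apply: dvdr_sum => j ji.
  case: (ltngtP j i) => [lt_ji|lt_ij|eq_ji].
  - rewrite (_ : s`__ = 0) ?mulr0; first exact: dvdr0.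
    by apply: nth_default; rewrite mS -addnBAC ?(ltnW lt_ji) // -add1n leq_add2r subn_gt0.
  - have : dvdr a%:P ((p`_j)%:P * s).
      by apply: IHk; rewrite (leq_trans le_p) // -addSnnS leq_add2r.
    move/(dvdr_polyC_coef (i + m - j)); by rewrite coefCM.
  - by case/eqP: ji; apply: val_inj.
(* Removing the leading term, divisible by [a] through [top], lowers the degree, and [a] still
   divides [p * s']: the outer induction applies to [s']. *)
pose s' := (p`_i)%:P * s - (p`_i * s`_m)%:P * 'X^m.
suff : dvdr a%:P s'.
  move=> h; rewrite -[X in dvdr _ X](subrK ((p`_i * s`_m)%:P * 'X^m)).
  by apply: dvdrD => //; apply: dvdr_mulr.
apply: IHn; last first.
  rewrite /s' mulrBr; apply: dvdrB; first by rewrite mulrCA; apply: dvdr_mull.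
  by apply: dvdr_mull; apply: dvdr_mulr.
suff: (size s' <= m)%N by rewrite -ltnS -mS => h; apply: leq_trans h _; rewrite -ltnS.
apply/leq_sizeP => j; rewrite leq_eqVlt => /orP[/eqP <-|lt_mj].
  by rewrite coefB !coefCM coefXn eqxx mulr1 subrr.
rewrite coefB !coefCM coefXn (gtn_eqF lt_mj) mulr0 subr0.
by rewrite [s`_j]nth_default ?mulr0 // mS.
Qed.

Hypothesis hPID : PID R.

(** [g] generates the ideal spanned by the coefficients, hence divides each of them; dividing by [g]
    the relation that expresses it through them gives unimodularity. *)
Lemma primitive_part p : p != 0 ->
  exists g p0, [/\ g != 0, p = g%:P * p0 & unimodular p0].
Proof.
move=> p0.
pose S a := exists u : nat -> R, a = \sum_(i < size p) u i * p`_i.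
have [|g gS] := @hPID S.
  split; first by exists (fun=> 0); rewrite big1 // => i _; rewrite mul0r.
  split => [a b [u ->] [v ->]|c a [u ->]].
    by exists (fun i => u i - v i); rewrite -sumrB; apply: eq_bigr => i _; rewrite mulrBl.
  by exists (fun i => c * u i); rewrite mulr_sumr; apply: eq_bigr => i _; rewrite mulrA.
have gp : dvdr g%:P p.
  apply: coef_dvdr_polyC => i; case: (ltnP i (size p)) => [lt_i|le_i]; last first.
    by rewrite nth_default //; apply: dvdr0.
  apply/gS; pose j := Ordinal lt_i.
  exists (fun j' => (j' == i)%:R); rewrite (bigD1 j) //= eqxx mul1r big1 ?addr0 //.
  by move=> j' jj; rewrite (negPf (jj : (j' : nat) != i)) mul0r.
have [u gu] := (gS g).2 (dvdr_refl g).
case: gp => q pE.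
have g0 : g != 0 by apply: contraNneq p0 => g0; rewrite pE g0 mulr0.
exists g, q; split=> //; first by rewrite mulrC.
have sq : size p = size q by rewrite pE mulrC mul_polyC size_scale.
exists u; apply: (mulIf g0); rewrite mul1r [RHS]gu sq mulr_suml.
by apply: eq_bigr => i _; rewrite pE coefMC mulrA.
Qed.

(** The content is a unit because the cofactor [q] is not constant. *)
Lemma irreducible_unimodular p : irreducibleR p -> (1 < size p)%N -> unimodular p.
Proof.
move=> [p0 [_ irr]] sp; have [g [q [g0 pE [u qu]]]] := primitive_part p0.
case: (irr _ _ pE) => [|]; last first.
  rewrite poly_unitE => /andP[/eqP sq _]; move: sp.
  by rewrite pE mul_polyC size_scale // sq.
rewrite poly_unitE coefC eqxx => /andP[_ gU].
exists (fun i => u i / g); rewrite -[RHS]qu.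
have -> : size p = size q by rewrite pE mul_polyC size_scale.
by apply: eq_bigr => i _; rewrite pE coefCM mulrA divrK.
Qed.

(** From a s = t p, Gauss's lemma gives that [a] divides [t], and [a] cancels. *)
Lemma unimodular_dvd_scale a p s : unimodular p -> a != 0 ->
  dvdr p (a%:P * s) -> dvdr p s.
Proof.
move=> pu a0 [t asE].
have [|t' tE] := @unimodular_gauss a p t pu.
  by exists s; rewrite mulrC -asE mulrC.
exists t'; apply: (mulfI (x := a%:P)); first by rewrite polyC_eq0.
by rewrite asE tE; ring.
Qed.

(** [gcdp] is a gcd only up to constants, so its primitive part [g] is used. Either [g] is associate
    to [p], and [p] divides [a], or [g] is a unit, and Bezout puts a nonzero constant into the ideal
    of [p] and [a]; then [p] divides a constant multiple of [b], hence [b]. *)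
Lemma irreducible_primeR p : irreducibleR p -> (1 < size p)%N -> primeR p.
Proof.
move=> pirr sp; have pu := irreducible_unimodular pirr sp.
case: (pirr) => p0 [pU irr]; split=> // a b [t abE].
have g0 : gcdp p a != 0 by rewrite gcdp_eq0 negb_and p0.
have [d [g [d0 gE gu]]] := primitive_part g0.
have g1 : g != 0 by apply: contraNneq g0 => g1; rewrite gE g1 mulr0.
(* Pseudo-divisibility holds after scaling by some [k]; unimodularity of [g] removes [k]. *)
have dvdg x : gcdp p a %| x -> dvdr g x.
  move=> /Pdiv.Idomain.dvdpP[[k q] /= k0 kE].
  apply: (unimodular_dvd_scale (a := k)) => //.
  by exists (q * d%:P); rewrite mul_polyC kE gE mulrA.
have [h pE] := dvdg p (dvdp_gcdl _ _).
case: (irr _ _ pE) => hU.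
  left; apply: dvdr_trans (dvdg a (dvdp_gcdr _ _)).
  by exists h^-1; rewrite pE mulrA mulVr // mul1r.
right; have [[u v] /= /eqpP[[k1 k2] /= /andP[k10 k20] uvE]] := Bezoutp p a.
move: hU; rewrite poly_unitE => /andP[/eqP/eqP/size_poly1P [e e0 ge] _].
have E : (k2 * d * e)%:P = k1%:P * (u * p + v * a).
  by rewrite !polyCM -mulrA -ge -gE !mul_polyC uvE.
apply: (unimodular_dvd_scale (a := k2 * d * e)) => //.
  by rewrite !mulf_neq0.
by rewrite E; exists (k1%:P * (u * b + v * t)); ring: abE.
Qed.

End Gauss.

(** * Divisors of products of prime powers *)

Section Factorization.
Variables (R : idomainType) (ps : seq {poly R}).
Hypothesis ps_prime : forall i, (i < size ps)%N -> primeR ps`_i.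

Definition prod_pow (e : nat -> nat) := \prod_(i < size ps) ps`_i ^+ e i.

Lemma prod_powD e1 e2 :
  prod_pow (fun i => e1 i + e2 i)%N = prod_pow e1 * prod_pow e2.
Proof. by rewrite -big_split; apply: eq_bigr => i _; rewrite exprD. Qed.

Lemma prod_pow1 (i : 'I_(size ps)) : prod_pow (fun j => (j == i)%N) = ps`_i.
Proof.
rewrite /prod_pow (bigD1 i) //= eqxx expr1 big1 ?mulr1 // => j ji.
by rewrite (negPf (ji : (j : nat) != i)).
Qed.

Lemma prod_powS (i : 'I_(size ps)) (e : nat -> nat) :
  (0 < e i)%N -> prod_pow e = ps`_i * prod_pow (fun j => e j - (j == i))%N.
Proof.
move=> ei; rewrite -{1}(prod_pow1 i) -prod_powD; apply: eq_bigr => j _.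
by rewrite subnKC //; case: eqP => // ->.
Qed.

Lemma prod_pow_neq0 e : prod_pow e != 0.
Proof.
by apply/prodf_neq0 => i _; rewrite expf_neq0 //; case: (ps_prime (ltn_ord i)).
Qed.

(** Induction on the sum of the exponents: a prime of the product divides [x] or [y] and is
    cancelled there, being counted in [k] only in the first case. With no prime left, [x] divides a
    nonzero constant and is constant. *)
Lemma divisor_prod_pow (u : R) e x y : u != 0 ->
    x * y = u%:P * prod_pow e ->
  exists k x0, [/\ forall i, (k i <= e i)%N, x0 != 0 & x = x0%:P * prod_pow k].
Proof.
move=> u0; have [n] := ubnP (\sum_(i < size ps) e i)%N.
elim: n e x y => // n IHn e x y le_e xyE.
case: (boolP [exists i : 'I_(size ps), (0 < e i)%N]) => [/existsP[i ei]|].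
  have [p0 _ pP] := ps_prime (ltn_ord i).
  have lt_e : (\sum_(j < size ps) (e j - (j == i)) < n)%N.
    rewrite -ltnS (leq_trans _ le_e) // ltnS (bigD1 i) //= [X in (_ < X)%N](bigD1 i) //=.
    rewrite eqxx -addSn leq_add //; first by rewrite subn1 prednK.
    by apply: leq_sum => j _; apply: leq_subr.
  have [] : dvdr ps`_i x \/ dvdr ps`_i y.
  - by apply: pP; rewrite xyE (prod_powS ei); apply/dvdr_mull/dvdr_mulr/dvdr_refl.
  - move=> [x' xE]; have [|k [x0 [ke x00 x'E]]] := IHn (fun j => e j - (j == i))%N x' y lt_e.
      by apply: (mulIf p0); rewrite mulrAC -xE xyE (prod_powS ei); ring.
    exists (fun j : nat => (j == i :> nat) + k j)%N, x0; split=> // [j|].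
      have := ke j; case: eqP => [->|_]; rewrite ?subn0 // ?subn1 add1n => h.
      by rewrite -(prednK ei) ltnS.
    by rewrite prod_powD prod_pow1 xE x'E; ring.
  - move=> [y' yE]; have [|k [x0 [ke x00 x'E]]] := IHn (fun j => e j - (j == i))%N x y' lt_e.
      by apply: (mulIf p0); rewrite -mulrA -yE xyE (prod_powS ei); ring.
    exists k, x0; split=> // j; exact: leq_trans (ke j) (leq_subr _ _).
rewrite negb_exists => /forallP e0.
have e1 : prod_pow e = 1.
  by rewrite /prod_pow big1 // => i _; move: (e0 i); rewrite lt0n negbK => /eqP->.
exists (fun=> 0%N), x`_0; rewrite /prod_pow big1 // mulr1.
have xy : size (x * y) = 1%N by rewrite xyE e1 mulr1 size_polyC u0.
have x0 : x != 0 by apply: contra_eq_neq xy => ->; rewrite mul0r size_poly0.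
have y0 : y != 0 by apply: contra_eq_neq xy => ->; rewrite mulr0 size_poly0.
have /size_poly1P[a a0 xE] : size x == 1%N.
  move: xy; rewrite size_mul // => /eqP.
  have := x0; have := y0; rewrite -!size_poly_gt0.
  by case: (size x) => [|[|s]] //; case: (size y) => // t; rewrite addnS.
by rewrite xE coefC.
Qed.

End Factorization.

(** * Ore polynomials over a domain, without fractions *)

Section OreAlgebra.
Variables (S : idomainType) (sigma : {rmorphism S -> S}) (sigmainv delta : S -> S).
Hypothesis sigmaK : cancel sigma sigmainv.
Hypothesis sigmainvK : cancel sigmainv sigma.
Hypothesis deltaD : forall p q, delta (p + q) = delta p + delta q.
Hypothesis deltaM : forall p q, delta (p * q) = sigma p * delta q + delta p * q.
Implicit Types (p : S) (A B P : {poly S}).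

Lemma delta0 : delta 0 = 0.
Proof. by apply: (addrI (delta 0)); rewrite -deltaD !addr0. Qed.

Lemma sigma_eq0 p : (sigma p == 0) = (p == 0).
Proof. by rewrite -[RHS](can_eq sigmaK) rmorph0. Qed.

Lemma iter_sigma_eq0 n p : (iter n sigma p == 0) = (p == 0).
Proof. by elim: n => //= n IHn; rewrite sigma_eq0. Qed.

Lemma iter_sigmaK n : cancel (iter n sigma) (iter n sigmainv).
Proof. by elim: n => // n IHn p; rewrite iterSr iterS sigmaK IHn. Qed.

Lemma iter_sigmainvK n : cancel (iter n sigmainv) (iter n sigma).
Proof. by elim: n => // n IHn p; rewrite iterSr iterS sigmainvK IHn. Qed.

Lemma iter_sigmaB n p q : iter n sigma (p - q) = iter n sigma p - iter n sigma q.
Proof. by elim: n => //= n ->; rewrite rmorphB. Qed.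

Lemma iter_sigmaM n p q : iter n sigma (p * q) = iter n sigma p * iter n sigma q.
Proof. by elim: n => //= n ->; rewrite rmorphM. Qed.

(** Counterpart of [ore_dmul] over the domain itself, where no representatives of fractions are
    chosen. *)
Definition dmul B := map_poly sigma B * 'X + map_poly delta B.

Definition omul A B := \sum_(i < size A) A`_i *: iter i dmul B.

Lemma coef_dmul B i :
  (dmul B)`_i = (if i is j.+1 then sigma B`_j else 0) + delta B`_i.
Proof.
rewrite coefD coefMX [(map_poly delta B)`_i]coef_map_id0 ?delta0 //.
by case: i => [|i] //=; rewrite coef_map.
Qed.

Lemma dmulD A B : dmul (A + B) = dmul A + dmul B.
Proof.
apply/polyP => i; rewrite [RHS]coefD !coef_dmul !coefD deltaD.
by case: i => [|i]; rewrite ?coefD ?rmorphD /=; ring.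
Qed.

Lemma dmul0 : dmul 0 = 0.
Proof. by rewrite /dmul !map_poly0 mul0r addr0. Qed.

Lemma dmulZ p B : dmul (p *: B) = sigma p *: dmul B + delta p *: B.
Proof.
apply/polyP => i; rewrite [RHS]coefD !coefZ !coef_dmul !coefZ deltaM.
by case: i => [|i]; rewrite ?coefZ ?rmorphM /=; ring.
Qed.

Lemma dmul_sum n (F : nat -> {poly S}) :
  dmul (\sum_(i < n) F i) = \sum_(i < n) dmul (F i).
Proof. by apply: (big_morph _ dmulD dmul0). Qed.

Lemma iter_dmulD n A B : iter n dmul (A + B) = iter n dmul A + iter n dmul B.
Proof. by elim: n => //= n ->; rewrite dmulD. Qed.

Lemma iter_dmul0 n : iter n dmul 0 = 0.
Proof. by elim: n => //= n ->; rewrite dmul0. Qed.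

Lemma dmul_top k B : (size B <= k.+1)%N ->
  (size (dmul B) <= k.+2)%N /\ (dmul B)`_k.+1 = sigma B`_k.
Proof.
move=> le_B; split; last by rewrite coef_dmul [B`_k.+1]nth_default // delta0 addr0.
apply/leq_sizeP => j le_j; rewrite coef_dmul !nth_default ?delta0 ?addr0 //.
  by case: j le_j => // j le_j; rewrite nth_default ?rmorph0 // (leq_trans le_B).
by rewrite (leq_trans le_B) // ltnW.
Qed.

Lemma size_dmul_le k B : (size B <= k)%N -> (size (dmul B) <= k.+1)%N.
Proof.
case: k => [|k /dmul_top[]//].
by rewrite leqn0 size_poly_eq0 => /eqP->; rewrite dmul0 size_poly0.
Qed.

Lemma iter_dmul_top j k B : (size B <= k.+1)%N ->
  (size (iter j dmul B) <= (j + k).+1)%N /\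
  (iter j dmul B)`_(j + k) = iter j sigma B`_k.
Proof.
move=> le_B; elim: j => //= j [IH1 IH2]; have [-> ->] := dmul_top IH1.
by rewrite IH2.
Qed.

Lemma omul_widen n A B : (size A <= n)%N ->
  omul A B = \sum_(i < n) A`_i *: iter i dmul B.
Proof.
move=> le_A; rewrite /omul (big_ord_widen n (fun i => A`_i *: iter i dmul B)) //.
rewrite big_mkcond; apply: eq_bigr => i _; case: ltnP => // le_i.
by rewrite nth_default ?scale0r.
Qed.

Lemma omulDl A1 A2 B : omul (A1 + A2) B = omul A1 B + omul A2 B.
Proof.
rewrite !(@omul_widen (maxn (size A1) (size A2))) ?leq_maxl ?leq_maxr ?size_polyD //.
by rewrite -big_split; apply: eq_bigr => i _; rewrite coefD scalerDl.
Qed.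

Lemma omulZl p A B : omul (p *: A) B = p *: omul A B.
Proof.
rewrite !(@omul_widen (size A)) ?size_scale_leq // scaler_sumr.
by apply: eq_bigr => i _; rewrite coefZ scalerA.
Qed.

(** Associativity for the left factor ∂: expanding each summand by [dmulZ] produces the two parts of
    [coef_dmul], one of them with its index shifted. *)
Lemma omul_dmul A B : omul (dmul A) B = dmul (omul A B).
Proof.
rewrite (@omul_widen (size A).+1 (dmul A)) ?size_dmul_le // /omul.
rewrite (dmul_sum _ (fun i => A`_i *: iter i dmul B)).
under eq_bigr do rewrite coef_dmul scalerDl.
rewrite big_split big_ord_recl /= scale0r add0r [X in _ + X]big_ord_recr /=.
rewrite [X in delta X]nth_default // delta0 scale0r addr0 -big_split.
by apply: eq_bigr => i _; rewrite dmulZ.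
Qed.

Lemma omul_top n k A B : (size A <= n.+1)%N -> (size B <= k.+1)%N ->
  (size (omul A B) <= (n + k).+1)%N /\ (omul A B)`_(n + k) = A`_n * iter n sigma B`_k.
Proof.
move=> le_A le_B; rewrite (omul_widen _ le_A).
have lt_i i : (i < n)%N -> (size (A`_i *: iter i dmul B)%R <= n + k)%N.
  move=> lt_in; apply: leq_trans (size_scale_leq _ _) _.
  by have [h _] := iter_dmul_top i le_B; rewrite (leq_trans h) // -addSn leq_add2r.
have lt_s : (size (\sum_(i < n) A`_i *: iter i dmul B)%R <= n + k)%N.
  by apply: leq_trans (size_sum _ _ _) _; apply/bigmax_leqP => i _; apply: lt_i.
have [h1 h2] := iter_dmul_top n le_B.
rewrite big_ord_recr /= coefD (nth_default _ lt_s) add0r coefZ h2.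
split=> //.
rewrite (leq_trans (size_polyD _ _)) // geq_max leqW //=.
exact: leq_trans (size_scale_leq _ _) h1.
Qed.

(** The top coefficient in [omul_top] is nonzero, as [S] is a domain and [sigma] is injective. *)
Lemma size_omul n k A B : size A = n.+1 -> size B = k.+1 ->
  size (omul A B) = (n + k).+1.
Proof.
move=> sA sB; have [|//|le top] := @omul_top n k A B; rewrite ?sA ?sB //.
apply/eqP; rewrite eqn_leq le /= ltnNge; apply: contra_neqN (_ : (omul A B)`_(n + k) != 0).
  by move=> ?; rewrite nth_default.
have lc0 (C : {poly S}) m : size C = m.+1 -> C`_m != 0.
  by move=> sC; have := lead_coef_eq0 C; rewrite lead_coefE -size_poly_eq0 sC /= => ->.
by rewrite top mulf_neq0 ?iter_sigma_eq0 ?lc0.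
Qed.

(** * Top coefficients in the left ideal generated by operators of bounded order *)

Section Generation.
Variables (M : {poly S} -> Prop) (l : nat).
Hypothesis M0 : M 0.
Hypothesis MD : forall P Q, M P -> M Q -> M (P + Q).
Hypothesis MZ : forall p P, M P -> M (p *: P).
Hypothesis M_size : forall P, M P -> (size P <= l.+1)%N.
Hypothesis M_dmul : forall P, M P -> (size P <= l)%N -> M (dmul P).

(** No polynomial coefficients stand left of the powers of ∂, so the top coefficient of a summand is
    just a [sigma]-iterate; [spanM_omul] brings left multiples of elements of [M] into this form. *)
Definition spanM P := exists n (m : nat -> {poly S}),
  (forall i, M (m i)) /\ P = \sum_(i < n) iter i dmul (m i).

Lemma spanM_widen n (m : nat -> {poly S}) n' : (n <= n')%N ->
  \sum_(i < n) iter i dmul (m i) =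
  \sum_(i < n') iter i dmul (if (i < n)%N then m i else 0).
Proof.
move=> le_n; rewrite (big_ord_widen n' (fun i => iter i dmul (m i))) // big_mkcond.
by apply: eq_bigr => i _; case: ltnP => // _; rewrite iter_dmul0.
Qed.

Lemma spanMD P Q : spanM P -> spanM Q -> spanM (P + Q).
Proof.
move=> [n1 [m1 [M1 ->]]] [n2 [m2 [M2 ->]]].
exists (maxn n1 n2), (fun i =>
  (if (i < n1)%N then m1 i else 0) + (if (i < n2)%N then m2 i else 0)).
split; first by move=> i; apply: MD; case: ltnP.
rewrite (spanM_widen _ (leq_maxl n1 n2)) (spanM_widen _ (leq_maxr n1 n2)) -big_split.
by apply: eq_bigr => i _; rewrite iter_dmulD.
Qed.

Lemma spanM0 : spanM 0.
Proof. by exists 0%N, (fun=> 0); rewrite big_ord0. Qed.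

Lemma spanM_sub P : M P -> spanM P.
Proof. by move=> MP; exists 1%N, (fun=> P); rewrite big_ord_recl big_ord0 addr0. Qed.

Lemma spanM_dmul P : spanM P -> spanM (dmul P).
Proof.
move=> [n [m [Mm ->]]].
exists n.+1, (fun i => if i is j.+1 then m j else 0); split; first by case.
by rewrite (dmul_sum _ (fun i => iter i dmul (m i))) big_ord_recl /= add0r.
Qed.

Lemma spanM_iter_dmulZ j p P : M P -> spanM (p *: iter j dmul P).
Proof.
move=> MP; elim: j p => [|j IHj] p; first exact/spanM_sub/MZ.
(* Moves [p] to the right of ∂: with q = [sigmainv p], the commutation rule reads p ∂ = ∂ q -
   delta(q). *)
have -> : p *: iter j.+1 dmul P =
    dmul (sigmainv p *: iter j dmul P) + (- delta (sigmainv p)) *: iter j dmul P.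
  by rewrite dmulZ sigmainvK scaleNr addrK.
by apply: spanMD; [apply: spanM_dmul|]; apply: IHj.
Qed.

Lemma spanM_omul A P : M P -> spanM (omul A P).
Proof.
move=> MP; apply: (big_ind spanM) => [||i _]; [exact: spanM0 | exact: spanMD |].
exact: spanM_iter_dmulZ.
Qed.

(* A summand [iter n dmul m] above the order of [P] has [m] of order below [l],
   hence [dmul m] is in [M] and the summand can be pushed one step down. *)
Lemma spanM_top P j : spanM P -> (size P <= (j + l).+1)%N ->
  exists2 m, M m & P`_(j + l) = iter j sigma m`_l.
Proof.
move=> [n [m [Mm ->]]].
have low i k : (i < k)%N -> (iter i dmul (m i))`_(k + l) = 0.
  move=> lt_ik; apply: nth_default; have [h _] := iter_dmul_top i (M_size (Mm i)).
  by rewrite (leq_trans h) // -addSn leq_add2r.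
have iter0 k : iter k sigma 0 = 0 by apply/eqP; rewrite iter_sigma_eq0.
elim: n m Mm low => [|n IHn] m Mm low le_P.
  by exists 0; rewrite // big_ord0 !coef0 iter0.
(* [n] is the index of the last summand; if it is below [j], all summands have degree below [j + l]
   and the coefficient is 0. *)
case: (ltngtP n j) => [lt_nj|lt_jn|eq_nj].
- exists 0; rewrite // coef_sum coef0 iter0 big1 // => i _.
  by apply: low; rewrite (leq_trans (ltn_ord i)).
(* Degree [n + l] lies above the degree of the sum and is reached by the last summand only, so the
   coefficient [l] of [m n] vanishes. *)
- have mn0 : (m n)`_l = 0.
    apply/eqP; rewrite -(iter_sigma_eq0 n); have [_ <-] := iter_dmul_top n (M_size (Mm n)).
    apply/eqP; rewrite -[RHS](_ : (\sum_(i < n.+1) iter i dmul (m i))`_(n + l) = 0).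
      rewrite big_ord_recr /= coefD coef_sum big1 ?add0r // => i _; exact: low.
    by apply: nth_default; rewrite (leq_trans le_P) // -addSn leq_add2r.
  have le_mn : (size (m n) <= l)%N.
    apply/leq_sizeP => k; rewrite leq_eqVlt => /orP[/eqP<- //|lt_lk].
    by rewrite nth_default // (leq_trans (M_size (Mm n))).
  case: n => // n in lt_jn IHn le_P mn0 le_mn *.
  pose m' i := m i + (if i == n then dmul (m n.+1) else 0).
  have Mm' i : M (m' i) by apply: MD => //; case: eqP => // _; apply: M_dmul.
  have E : \sum_(i < n.+2) iter i dmul (m i) = \sum_(i < n.+1) iter i dmul (m' i).
    rewrite big_ord_recr /= -(iterS n dmul) iterSr big_ord_recr [RHS]big_ord_recr /= /m' eqxx.
    rewrite iter_dmulD addrA; congr (_ + _ + _).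
    by apply: eq_bigr => i _; rewrite (ltn_eqF (ltn_ord i)) addr0.
  rewrite E in le_P *; apply: IHn => // i k lt_ik; apply: nth_default.
  have [h _] := iter_dmul_top i (M_size (Mm' i)).
  by rewrite (leq_trans h) // -addSn leq_add2r.
- exists (m j) => //; rewrite eq_nj big_ord_recr /= coefD coef_sum big1 ?add0r.
    by have [_ ->] := iter_dmul_top j (M_size (Mm j)).
  by move=> i _; apply: low.
Qed.

End Generation.

Definition contS (L P : {poly S}) := exists b A, b != 0 /\ b *: P = omul A L.

Lemma contS_refl L : contS L L.
Proof.
exists 1, 1; split; first exact: oner_neq0.
by rewrite scale1r /omul size_poly1 big_ord_recl big_ord0 coef1 scale1r addr0.
Qed.

Lemma contS_Z L p P : contS L P -> contS L (p *: P).
Proof.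
move=> [b [A [b0 E]]]; exists b, (p *: A); split=> //.
by rewrite omulZl -E !scalerA mulrC.
Qed.

Lemma contS_D L P Q : contS L P -> contS L Q -> contS L (P + Q).
Proof.
move=> [b1 [A1 [b10 E1]]] [b2 [A2 [b20 E2]]].
exists (b1 * b2), (b2 *: A1 + b1 *: A2); split; first exact: mulf_neq0.
by rewrite omulDl !omulZl -E1 -E2 scalerDr !scalerA (mulrC b2).
Qed.

Lemma contS_B L P Q : contS L P -> contS L Q -> contS L (P - Q).
Proof. by move=> cP cQ; rewrite -scaleN1r; apply/contS_D/contS_Z. Qed.

Lemma contS0 L : contS L 0.
Proof. by rewrite -(scale0r L); apply/contS_Z/contS_refl. Qed.

Lemma contS_dmul L P : contS L P -> contS L (dmul P).
Proof.
(* From sigma(b) ∂ P = ∂ (b P) - delta(b) P, multiplied by [b] so that b P = A L can be substituted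
   in both terms. *)
move=> [b [A [b0 E]]]; exists (b * sigma b), (b *: dmul A - delta b *: A).
split; first by rewrite mulf_neq0 ?sigma_eq0.
rewrite -scaleNr omulDl !omulZl omul_dmul -E dmulZ (scalerDr b) !scalerA.
by rewrite -addrA -scalerDl mulNr [delta b * b]mulrC subrr scale0r addr0.
Qed.

Lemma contS_iter_dmul L P n : contS L P -> contS L (iter n dmul P).
Proof. by move=> cP; elim: n => //= n; apply: contS_dmul. Qed.

Lemma contS_size L P : L != 0 -> P != 0 -> contS L P ->
  exists k, size P = (k + (size L).-1).+1.
Proof.
move=> L0 P0 [b [A [b0 E]]].
have A0 : A != 0.
  apply: contraNneq P0 => A0; move/eqP: E.
  by rewrite A0 /omul size_poly0 big_ord0 -mul_polyC mulf_eq0 polyC_eq0 (negPf b0).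
exists (size A).-1; rewrite -(size_scale P b0) E (@size_omul (size A).-1 (size L).-1) //.
  by rewrite prednK // size_poly_gt0.
by rewrite prednK // size_poly_gt0.
Qed.

End OreAlgebra.

(** * Fractions of polynomials and common denominators *)

Section Fractions.
Variable R : idomainType.
Local Notation K := {fraction {poly R}}.

Lemma tofrac_numden (u : K) :
  u * (FracField.tofrac (frac (repr u)).2) = FracField.tofrac (frac (repr u)).1.
Proof.
move: (repr u) (reprK u) => x <-; rewrite !piE; apply/eqP.
have d0 := denom_ratioP x.
rewrite eqmodE /= FracField.equivfE /= /FracField.mulf.
by rewrite !numden_Ratio ?mulr1 ?oner_neq0 // mulrC.
Qed.

Lemma tofrac_neq0 (p : {poly R}) : p != 0 -> FracField.tofrac p != 0.
Proof. by rewrite tofrac_eq0. Qed.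

(** The representative n / d chosen for [p%:F] satisfies n = p d, but d may differ from 1;
    multiplicativity of [s] cancels s(d). *)
Lemma liftK_tofrac (s : {poly R} -> {poly R}) p :
    {morph s : x y / x * y} -> (forall x, x != 0 -> s x != 0) ->
  Defs.liftK s p%:F = (s p)%:F.
Proof.
move=> sM s0; rewrite /Defs.liftK; have := tofrac_numden p%:F.
have := denom_ratioP (repr p%:F).
move: (frac (repr p%:F)) => [n d] /= d0 /eqP.
rewrite -tofracM tofrac_eq => /eqP <-.
by rewrite sM tofracM mulfK // tofrac_neq0 ?s0.
Qed.

Lemma clear_denominators (A : {poly K}) :
  exists (b : {poly R}) A', b != 0 /\ b%:F *: A = emb A'.
Proof.
elim/poly_ind: A => [|A u [b [A' [b0 E]]]].
  by exists 1, 0; split; rewrite ?oner_neq0 // scaler0 /emb map_poly0.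
have := tofrac_numden u; have := denom_ratioP (repr u).
move: (frac (repr u)) => [n d] /= d0 uE.
exists (b * d), (d *: A' * 'X + (b * n)%:P); split; first by rewrite mulf_neq0.
apply/polyP => i; rewrite coefZ coefD coefMX coefC coef_map_id0 ?tofrac0 // coefD coefMX coefC.
case: i => [|i] /=.
  by rewrite !add0r !tofracM -uE; ring.
rewrite !addr0 coefZ !tofracM mulrAC.
have -> : (b%:F * A`_i) = (A'`_i)%:F.
  by have := congr1 (fun P : {poly K} => P`_i) E; rewrite coefZ coef_map_id0 ?tofrac0.
by rewrite mulrC.
Qed.

End Fractions.

(** * Transfer between operators over the fraction field and over R[x] *)

Section OreFractions.
Variables (R : idomainType) (sigma : {rmorphism {poly R} -> {poly R}}).
Variables (sigmainv delta : {poly R} -> {poly R}).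
Hypothesis sigmaK : cancel sigma sigmainv.
Hypothesis sigmainvK : cancel sigmainv sigma.
Hypothesis deltaD : forall p q, delta (p + q) = delta p + delta q.
Hypothesis deltaM : forall p q, delta (p * q) = sigma p * delta q + delta p * q.
Local Notation K := {fraction {poly R}}.
Implicit Types (p q : {poly R}) (A B P L Q : {poly {poly R}}).
Local Notation dmul := (dmul sigma delta).
Local Notation omul := (omul sigma delta).

Lemma liftK_sigma p : Defs.liftK sigma p%:F = (sigma p)%:F.
Proof.
by apply: liftK_tofrac => [x y|x]; rewrite ?rmorphM ?(sigma_eq0 sigmaK).
Qed.

Lemma sigmainvM : {morph sigmainv : p q / p * q}.
Proof. by move=> p q; apply: (can_inj sigmaK); rewrite rmorphM !sigmainvK. Qed.

Lemma liftK_sigmainv p : Defs.liftK sigmainv p%:F = (sigmainv p)%:F.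
Proof.
apply: liftK_tofrac; first exact: sigmainvM.
by move=> x; rewrite -(sigma_eq0 sigmaK (sigmainv x)) sigmainvK.
Qed.

Lemma sigZN k p : sigZ sigma sigmainv (- k%:Z) p%:F = (iter k sigmainv p)%:F.
Proof.
case: k => [|k] //=.
have -> j : iter j (Defs.liftK sigmainv) p%:F = (iter j sigmainv p)%:F.
  by elim: j => //= j ->; rewrite liftK_sigmainv.
by rewrite liftK_sigmainv.
Qed.

(** On a representative p d / d, the Leibniz rule turns delta(p d) - sigma(p) delta(d) into delta(p)
    d. *)
Lemma deltaK_tofrac p : deltaK sigma delta p%:F = (delta p)%:F.
Proof.
rewrite /deltaK liftK_sigma; have := tofrac_numden p%:F.
have := denom_ratioP (repr p%:F).
move: (frac (repr p%:F)) => [n d] /= d0 /eqP.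
rewrite -tofracM tofrac_eq => /eqP <-.
by rewrite deltaM -tofracM -tofracB addrC addKr tofracM mulfK // tofrac_neq0.
Qed.

Lemma coef_emb P i : (emb P)`_i = (P`_i)%:F.
Proof. by rewrite coef_map_id0 ?tofrac0. Qed.

Lemma emb_inj : injective (@emb R).
Proof.
move=> P Q E; apply/polyP => i; apply/eqP; rewrite -tofrac_eq.
by rewrite -!coef_emb E.
Qed.

Lemma embD P Q : emb (P + Q) = emb P + emb Q.
Proof. by apply/polyP => i; rewrite coefD !coef_emb coefD tofracD. Qed.

Lemma emb0 : emb (0 : {poly {poly R}}) = 0.
Proof. by rewrite /emb map_poly0. Qed.

Lemma embZ p P : emb (p *: P) = p%:F *: emb P.
Proof. by apply/polyP => i; rewrite coefZ !coef_emb coefZ tofracM. Qed.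

Lemma size_emb P : size (emb P) = size P.
Proof.
apply: size_map_inj_poly; last by rewrite tofrac0.
by move=> p q /eqP; rewrite tofrac_eq => /eqP.
Qed.

Lemma ore_dmul_emb P : ore_dmul sigma delta (emb P) = emb (dmul P).
Proof.
have l0 : Defs.liftK sigma 0 = 0 by rewrite -tofrac0 liftK_sigma rmorph0.
have d0 : deltaK sigma delta 0 = 0 by rewrite -tofrac0 deltaK_tofrac (delta0 deltaD).
apply/polyP => i; rewrite coef_emb (coef_dmul sigma deltaD) /ore_dmul coefD coefMX.
rewrite !coef_map_id0 ?tofrac0 // deltaK_tofrac tofracD; case: i => [|i] /=.
  by rewrite tofrac0.
by rewrite liftK_sigma.
Qed.

Lemma ore_mul_emb A P : ore_mul sigma delta (emb A) (emb P) = emb (omul A P).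
Proof.
rewrite /ore_mul /omul size_emb (big_morph _ embD emb0); apply: eq_bigr => i _.
rewrite coef_emb embZ; congr (_ *: _).
by elim: (nat_of_ord i) => //= j ->; rewrite ore_dmul_emb.
Qed.

Lemma ore_mulZl (a : K) (A B : {poly K}) : a != 0 ->
  ore_mul sigma delta (a *: A) B = a *: ore_mul sigma delta A B.
Proof.
move=> a0; rewrite /ore_mul size_scale // scaler_sumr.
by apply: eq_bigr => i _; rewrite coefZ scalerA.
Qed.

Lemma contE L P : cont sigma delta L P <-> contS sigma delta L P.
Proof.
split=> [[A E]|[b [A [b0 E]]]].
  have [b [A' [b0 E']]] := clear_denominators A.
  exists b, A'; split=> //; apply: emb_inj.
  by rewrite -ore_mul_emb -E' ore_mulZl ?tofrac_neq0 // E embZ.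
exists ((b%:F)^-1 *: emb A).
rewrite ore_mulZl ?invr_eq0 ?tofrac_neq0 // ore_mul_emb -E embZ scalerA.
by rewrite mulVf ?scale1r ?tofrac_neq0.
Qed.

Lemma size_ore_mul (A : {poly K}) L Q k : L != 0 -> size A = k.+1 ->
  ore_mul sigma delta A (emb L) = emb Q -> size Q = (k + (size L).-1).+1.
Proof.
move=> L0 sA E; have [b [A' [b0 E']]] := clear_denominators A.
have bF0 := tofrac_neq0 b0.
have EQ : b *: Q = omul A' L.
  by apply: emb_inj; rewrite -ore_mul_emb -E' ore_mulZl // E embZ.
rewrite -(size_scale Q b0) EQ (size_omul sigmaK deltaD (n := k) (k := (size L).-1)) //.
  by rewrite -size_emb -E' size_scale.
by rewrite prednK // size_poly_gt0.
Qed.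

(** [spanM_top] applied to M_l(L), which is stable under ∂ below order [l]: I_(j+l) lies in
    sigma^j(I_l). *)
Lemma Mk_generates_top L l P j :
    Mk_generates sigma delta L l -> cont sigma delta L P ->
    (size P <= (j + l).+1)%N ->
  exists2 m, Mk sigma delta L l m & P`_(j + l) = iter j sigma m`_l.
Proof.
move=> gen cP; have [s [Ms E]] := gen P cP.
have M0 : Mk sigma delta L l 0.
  by split; [apply/contE/contS0 | rewrite size_poly0].
have MD A B : Mk sigma delta L l A -> Mk sigma delta L l B -> Mk sigma delta L l (A + B).
  move=> [cA sA] [cB sB]; split; first by apply/contE/contS_D; apply/contE.
  by rewrite (leq_trans (size_polyD _ _)) // geq_max sA.
have MZ p A : Mk sigma delta L l A -> Mk sigma delta L l (p *: A).
  move=> [cA sA]; split; first by apply/contE/contS_Z/contE.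
  exact: leq_trans (size_scale_leq _ _) sA.
apply: (@spanM_top _ _ _ _ _ _ (Mk sigma delta L l)) => //.
- by move=> A [].
- move=> A [cA _] sA; split; first by apply/contE/contS_dmul/contE.
  exact: size_dmul_le.
have -> : P = \sum_(q <- s) omul q.1 q.2.
  apply: emb_inj; rewrite E (big_morph _ embD emb0).
  by apply: eq_bigr => q _; rewrite ore_mul_emb.
rewrite big_seq; apply: (big_ind (spanM sigma delta (Mk sigma delta L l))) => [||q qs].
- exact: spanM0.
- exact: spanMD.
- by apply: spanM_omul => //; apply: Ms.
Qed.

End OreFractions.
Lemma tofrac_div_eq (T : idomainType) (x a b y : T) : b != 0 ->
  (x%:F = a%:F / b%:F * y%:F) <-> b * x = a * y.
Proof.
move=> b0; have bF0 : b%:F != 0 by rewrite tofrac_eq0.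
split=> [E|E].
  by apply/eqP; rewrite -tofrac_eq !tofracM E mulrA [b%:F * _]mulrC mulfVK.
by apply: (mulfI bF0); rewrite -tofracM E tofracM mulrA [b%:F * _]mulrC mulfVK.
Qed.

(** Gauss's lemma strips the factors [p] one by one until the constant divides 1. *)
Lemma unimodular_exp_gauss (R : idomainType) (p : {poly R}) (a : R) n :
  unimodular p -> dvdr a%:P (p ^+ n) -> a \is a GRing.unit.
Proof.
move=> pu; elim: n => [[q E]|n IHn]; last by rewrite exprS => /(unimodular_gauss pu).
apply/unitrPr; exists q`_0; have := congr1 (fun s : {poly R} => s`_0) E.
by rewrite /= expr0 coef1 coefMC mulrC => <-.
Qed.

(** * Action of sigma on degrees and on constant divisors *)

Section Desingularization.
Variable R : idomainType.
Hypothesis hPID : PID R.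
Variables (gamma tau : R) (sigma : {rmorphism {poly R} -> {poly R}}).
Hypothesis gammaU : gamma \is a GRing.unit.
Hypothesis sigmaC : forall c : R, sigma c%:P = c%:P.
Hypothesis sigmaX : sigma 'X = gamma%:P * 'X + tau%:P.
Variables (sigmainv delta : {poly R} -> {poly R}).
Hypothesis sigmaK : cancel sigma sigmainv.
Hypothesis sigmainvK : cancel sigmainv sigma.
Hypothesis deltaD : forall p q, delta (p + q) = delta p + delta q.
Hypothesis deltaM : forall p q, delta (p * q) = sigma p * delta q + delta p * q.

(** [sigma] is composition with a polynomial of degree 1, as the unit [gamma] is nonzero. *)
Lemma size_sigma p : size (sigma p) = size p.
Proof.
have -> : sigma p = p \Po (gamma%:P * 'X + tau%:P).
  elim/poly_ind: p => [|p a IHp]; first by rewrite rmorph0 comp_poly0.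
  by rewrite rmorphD rmorphM /= IHp sigmaX sigmaC comp_polyD comp_polyM comp_polyX comp_polyC.
have g0 : gamma != 0 by apply: contraTneq gammaU => ->; rewrite unitr0.
apply: size_comp_poly2.
by rewrite size_MXaddC polyC_eq0 (negPf g0) size_polyC g0.
Qed.

Lemma size_iter_sigma n p : size (iter n sigma p) = size p.
Proof. by elim: n => //= n; rewrite size_sigma. Qed.

Lemma size_iter_sigmainv n p : size (iter n sigmainv p) = size p.
Proof. by rewrite -(size_iter_sigma n) iter_sigmainvK. Qed.

Lemma dvdrC_iter_sigma (a : R) n p : dvdr a%:P (iter n sigma p) <-> dvdr a%:P p.
Proof.
have fixC m (s : {poly R} -> {poly R}) : s a%:P = a%:P -> iter m s a%:P = a%:P.
  by move=> sE; elim: m => //= m ->.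
split=> [[q E]|[q ->]]; last first.
  by exists (iter n sigma q); rewrite iter_sigmaM fixC.
exists (iter n sigmainv q); apply: (can_inj (iter_sigmaK sigmaK n)).
by rewrite iter_sigmaM iter_sigmainvK // fixC.
Qed.

(** * Shifted leading coefficients of operators in cont(L) *)

Variable L : {poly {poly R}}.
Hypothesis ordr_gt0 : (0 < ordr L)%N.
Local Notation r := (ordr L).
Local Notation contL := (contS sigma delta L).

Let L0 : L != 0.
Proof. by apply: contraTneq ordr_gt0 => ->; rewrite /ordr size_poly0. Qed.

Let size_L : size L = r.+1.
Proof. by rewrite /ordr prednK // size_poly_gt0. Qed.

(* The union over k of the ideals sigma^(-k) (I_(k + r)). *)
Definition shifted_coef (g : {poly R}) := exists k P,
  [/\ contL P, (size P <= (k + r).+1)%N & P`_(k + r) = iter k sigma g].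

(** Left multiplication by ∂^j leaves the shifted coefficient [g] unchanged, so two witnesses can be
    brought to a common order. *)
Lemma shift_witness k P j g :
    contL P -> (size P <= (k + r).+1)%N -> P`_(k + r) = iter k sigma g ->
  exists P', [/\ contL P', (size P' <= (j + k + r).+1)%N
               & P'`_(j + k + r) = iter (j + k) sigma g].
Proof.
move=> cP sP PE; have [h1 h2] := @iter_dmul_top _ sigma _ deltaD j _ _ sP.
exists (iter j (dmul sigma delta) P); rewrite -addnA; split=> //.
  exact: contS_iter_dmul.
by rewrite h2 PE iterD.
Qed.

Lemma shifted_coefB g h : shifted_coef g -> shifted_coef h -> shifted_coef (g - h).
Proof.
move=> [k1 [P1 [c1 s1 E1]]] [k2 [P2 [c2 s2 E2]]].
have [P1' [c1' s1' E1']] := shift_witness k2 c1 s1 E1.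
have [P2' [c2' s2' E2']] := shift_witness k1 c2 s2 E2.
rewrite (addnC k1) in s2' E2'.
exists (k2 + k1)%N, (P1' - P2'); split; first exact: contS_B.
  by rewrite (leq_trans (size_polyD _ _)) // geq_max s1' size_polyN.
by rewrite coefB E1' E2' iter_sigmaB.
Qed.

Lemma shifted_coefM a g : shifted_coef g -> shifted_coef (a * g).
Proof.
move=> [k [P [cP sP E]]]; exists k, (iter k sigma a *: P); split.
- exact: contS_Z.
- exact: leq_trans (size_scale_leq _ _) sP.
- by rewrite coefZ E iter_sigmaM.
Qed.

Lemma shifted_coef_L : shifted_coef (lead_coef L).
Proof.
exists 0%N, L; split; [exact: contS_refl | by rewrite size_L | by []].
Qed.

Lemma shifted_coef_lead k P : contL P -> size P = (k + r).+1 ->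
  shifted_coef (iter k sigmainv (lead_coef P)).
Proof.
move=> cP sP; exists k, P; split=> //; first by rewrite sP.
by rewrite iter_sigmainvK // lead_coefE sP.
Qed.

(** * The coefficient ideal I_l *)

Variable l : nat.
Hypothesis gen : Mk_generates sigma delta L l.
Local Notation Il := (Ik sigma delta L l).

Lemma IkP p : Il p <-> exists2 P, Mk sigma delta L l P & P`_l = p.
Proof.
split=> [[->|[P [MP <-]]]|[P MP PE]].
- exists 0; rewrite ?coef0 //; split; last by rewrite size_poly0.
  by apply/contE => //; apply: contS0.
- by exists P.
- by right; exists P.
Qed.

Lemma Ik_B p q : Il p -> Il q -> Il (p - q).
Proof.
move=> /IkP[P [cP sP] <-] /IkP[Q [cQ sQ] <-]; apply/IkP; exists (P - Q).
  split; first by apply/contE => //; apply: contS_B; apply/contE.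
  by rewrite (leq_trans (size_polyD _ _)) // geq_max sP size_polyN.
by rewrite coefB.
Qed.

Lemma Ik_M a p : Il p -> Il (a * p).
Proof.
move=> /IkP[P [cP sP] <-]; apply/IkP; exists (a *: P); last by rewrite coefZ.
split; first by apply/contE => //; apply/contS_Z/contE.
exact: leq_trans (size_scale_leq _ _) sP.
Qed.

(** Two separate iterates avoid a signed exponent i - j; the relation suffices because [sigma]
    preserves degrees and divisibility by constants. *)
Lemma shifted_coef_Ik g : shifted_coef g ->
  exists i j h, [/\ Il h, iter i sigma g = iter j sigma h & size h = size g].
Proof.
(* Raising by ∂^l gives the order bound the form [k + r + l] required by [Mk_generates_top]. *)
move=> [k [P [cP sP E]]]; have [P' [cP' sP' E']] := shift_witness l cP sP E.
have e : (l + k + r = k + r + l)%N by rewrite -addnA addnC.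
have [||m Mm mE] := @Mk_generates_top _ _ _ _ sigmaK sigmainvK deltaD deltaM _ _ P' (k + r) gen.
- exact/contE.
- by rewrite -e.
have E2 : iter (l + k) sigma g = iter (k + r) sigma m`_l by rewrite -mE -e E'.
exists (l + k)%N, (k + r)%N, m`_l; split=> //; first by apply/IkP; exists m.
by rewrite -(size_iter_sigma (k + r)) -E2 size_iter_sigma.
Qed.

(** * The Groebner basis element of lowest degree *)

Variables (G : seq {poly R}) (f : {poly R}).
Hypothesis G_reduced : reduced_GB Il G.
Hypothesis fG : f \in G.
Hypothesis f_min : forall g, g \in G -> (size f <= size g)%N.

Lemma f_neq0 : f != 0.
Proof. by case: G_reduced => -[gG _] _; case: (gG _ fG). Qed.

Lemma f_Ik : Il f.
Proof. by case: G_reduced => -[gG _] _; case: (gG _ fG). Qed.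

Lemma Ik_size h : Il h -> h != 0 -> (size f <= size h)%N.
Proof.
case: G_reduced => -[_ gb] _ hI h0; have [g gG [gh _]] := gb _ hI h0.
exact: leq_trans (f_min gG) gh.
Qed.

Lemma Ik_small h : Il h -> (size h < size f)%N -> h = 0.
Proof.
move=> hI; rewrite ltnNge; apply: contraNeq => h0; exact: Ik_size.
Qed.

Let n := (size f).-1.

Let size_f : size f = n.+1.
Proof. by rewrite /n prednK // size_poly_gt0 f_neq0. Qed.

(* The leading coefficients of the elements of minimal degree form an ideal,
   whose generator is matched by some [g] in [G]; reducedness forces [g = f]. *)
Lemma Ik_lead_dvd h : Il h -> (size h <= size f)%N -> dvdr (lead_coef f) h`_n.
Proof.
move=> hI sh.
(* The leading coefficients in minimal degree [n], together with 0. *)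
pose S a := exists2 q, Il q & (size q <= size f)%N /\ q`_n = a.
have [|g0 gS] := @hPID S.
  split; first by exists 0; [left | rewrite size_poly0 coef0].
  split=> [a b [p pI [sp <-]] [q qI [sq <-]]|a b [p pI [sp <-]]].
    exists (p - q); first exact: Ik_B.
    by rewrite coefB (leq_trans (size_polyD _ _)) // geq_max sp size_polyN.
  exists (a%:P * p); first exact: Ik_M.
  by rewrite coefCM mul_polyC (leq_trans (size_scale_leq _ _)).
have fS : dvdr g0 (lead_coef f) by apply/gS; exists f; [exact: f_Ik|].
have hS : dvdr g0 h`_n by apply/gS; exists h.
have g00 : g0 != 0.
  case: fS => q E; apply: contraNneq f_neq0 => g00.
  by rewrite -lead_coef_eq0 E g00 mulr0.
have [h0 h0I [sh0 h0E]] := (gS g0).2 (dvdr_refl _).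
have h00 : h0 != 0 by apply: contraNneq g00 => E; rewrite -h0E E coef0.
have sh0f : size h0 = size f by apply/eqP; rewrite eqn_leq sh0 Ik_size.
case: G_reduced => -[_ gb] [_ red].
have [g gG [sg lg]] := gb _ h0I h00.
have lg0 : dvdr (lead_coef g) g0 by rewrite -h0E /n -sh0f -lead_coefE.
case: (eqVneq f g) => [->|fg]; first exact: dvdr_trans hS.
(* Here lc(g) divides [g0], which divides lc(f), so [g] would reduce the leading term of [f]. *)
case: (red f g fG gG fg n).
- by rewrite -size_f -sh0f.
- by rewrite /n -lead_coefE lead_coef_eq0 f_neq0.
- by rewrite /n -lead_coefE; apply: dvdr_trans fS.
Qed.

(** Cancelling the leading term by a constant multiple of [f] leaves an element of I_l of degree
    below deg f, hence 0. *)
Lemma Ik_min_multiple h : Il h -> (size h <= size f)%N -> dvdr f h.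
Proof.
move=> hI sh; have [e hE] := Ik_lead_dvd hI sh; exists e%:P.
apply/eqP; rewrite -subr_eq0; apply/eqP/Ik_small.
  by apply: Ik_B => //; apply/Ik_M/f_Ik.
rewrite size_f ltnS; apply/leq_sizeP => j; rewrite leq_eqVlt => /orP[/eqP<-|lt_nj].
  by rewrite coefB coefCM hE lead_coefE subrr.
by rewrite coefB coefCM !nth_default ?mulr0 ?subrr // (leq_trans _ lt_nj) -?size_f.
Qed.

(** * The operator F and its shifted leading coefficient *)

Variable F : {poly {poly R}}.
Hypothesis F_cont : cont sigma delta L F.
Hypothesis lead_F : lead_coef F = f.

Let F0 : F != 0.
Proof. by rewrite -lead_coef_eq0 lead_F f_neq0. Qed.

Lemma cont_size (P : {poly {poly R}}) : P != 0 -> cont sigma delta L P ->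
  exists k, size P = (k + r).+1.
Proof.
move=> P0 cP; apply: (contS_size sigmaK deltaD L0 P0).
exact/contE.
Qed.

Variable k : nat.
Hypothesis size_F : size F = (k + r).+1.

Let f' := iter k sigmainv f.

Let size_f' : size f' = size f.
Proof. exact: size_iter_sigmainv. Qed.

Let f'0 : f' != 0.
Proof. by rewrite -size_poly_gt0 size_f' size_f. Qed.

(** Pseudo-division by [f']: the remainder is again a shifted coefficient, of degree below deg f, so
    it is 0 by [shifted_coef_Ik] and minimality. *)
Lemma shifted_coef_multiple g : shifted_coef g ->
  exists a q, a != 0 /\ a%:P * g = q * f'.
Proof.
move=> gJ; exists (lead_coef f' ^+ scalp g f'), (g %/ f').
split; first by rewrite expf_neq0 // lead_coef_eq0.
have E := Pdiv.Idomain.divp_eq g f'.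
rewrite -mul_polyC in E.
have rem0 : g %% f' = 0.
  have : shifted_coef (g %% f').
    rewrite (_ : g %% f' = (lead_coef f' ^+ scalp g f')%:P * g - (g %/ f') * f').
      apply: shifted_coefB; apply: shifted_coefM => //.
      by rewrite /f' -lead_F; apply: shifted_coef_lead => //; apply/contE.
    by rewrite E addrC addKr.
  move/shifted_coef_Ik => [i [j [h [hI _ sh]]]].
  apply/eqP; rewrite -size_poly_eq0 -sh size_poly_eq0; apply/eqP/Ik_small => //.
  by rewrite sh -size_f' ltn_modp.
by rewrite E rem0 addr0.
Qed.

(** * Factorization of lc(L) and removable exponents *)

Variables (c : R) (ps : seq {poly R}) (e : nat -> nat).
Hypothesis L_fact : lead_coef L = c%:P * prod_pow ps e.
Hypothesis ps_irr :
  forall i, (i < size ps)%N -> irreducibleR ps`_i /\ (1 < size (nth 0%R ps i))%N.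
Hypothesis ps_coprime : forall i j, (i < size ps)%N -> (j < size ps)%N -> i <> j ->
  coprimeR ps`_i ps`_j.

Let ps_prime i : (i < size ps)%N -> primeR ps`_i.
Proof. by move/ps_irr => [irr sp]; apply: irreducible_primeR. Qed.

Let c0 : c != 0.
Proof.
move: L0; rewrite -lead_coef_eq0 L_fact; apply: contraNneq => ->.
by rewrite mul0r.
Qed.

(** The cofactor [u] in a lc(L) = u f' divides a constant multiple of the given prime factorization,
    so it is a constant times a product of these primes. *)
Lemma lead_factorization : exists a b ks,
  [/\ a != 0, b != 0, forall i, (ks i <= e i)%N
    & a%:P * lead_coef L = b%:P * prod_pow ps ks * f'].
Proof.
have [a [u [a0 E]]] := shifted_coef_multiple shifted_coef_L.
have [|ks [b [le_ks b0 uE]]] :=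
    divisor_prod_pow ps_prime (x := u) (y := f') (e := e) (mulf_neq0 a0 c0).
  by rewrite -E L_fact polyCM mulrA.
by exists a, b, ks; rewrite E uE.
Qed.

Variables (a b : R) (ks : nat -> nat).
Hypothesis a0 : a != 0.
Hypothesis b0 : b != 0.
Hypothesis le_ks : forall i, (ks i <= e i)%N.
Hypothesis lead_L : a%:P * lead_coef L = b%:P * prod_pow ps ks * f'.

Lemma prime_const_dvd i (x : R) : (i < size ps)%N -> x != 0 -> ~ dvdr ps`_i x%:P.
Proof.
move=> lt_i x0 [q E]; have [_ sp] := ps_irr lt_i.
have [p0 _ _] := ps_prime lt_i.
have q0 : q != 0.
  by apply: contraNneq x0 => q0; rewrite -polyC_eq0 E q0 mul0r.
have := congr1 (fun s : {poly R} => size s) E.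
rewrite /= size_mul // size_polyC x0; move: q0 sp; rewrite -size_poly_gt0.
by case: (size q) => // s _; case: (size _) => [|[|t]] // _; rewrite addSn !addnS.
Qed.

Lemma prod_pow_split (i : 'I_(size ps)) (d : nat -> nat) : prod_pow ps d =
  ps`_i ^+ d i * \prod_(j < size ps | j != i) ps`_j ^+ d j.
Proof. by rewrite /prod_pow (bigD1 i). Qed.

(** Removing p_i^d would give a shifted coefficient [g] with v p_i^d g = w lc(L). Since [g] is a
    multiple of [f'] up to constants, p_i^d would divide a constant times [w] times the product of
    the p_j^(ks j). *)
Lemma over_exponent_non_removable i d : (i < size ps)%N -> (ks i < d)%N ->
  non_removable sigma sigmainv delta (ps`_i ^+ d) L.
Proof.
move=> lt_i lt_d k' [_ [P [w [v [Q [sP [cop [v0 [E]]]]]]]]].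
have p_prime := ps_prime lt_i; have [p0 pU pP] := p_prime.
have pd0 : ps`_i ^+ d != 0 by rewrite expf_neq0.
rewrite (sigZN sigmaK sigmainvK) -tofracM tofrac_div_eq ?mulf_neq0 //.
have sQ := size_ore_mul sigmaK deltaD deltaM L0 sP E.
set g := iter k' sigmainv _ => gE.
have [|al [s [al0 sE]]] := @shifted_coef_multiple g.
  by apply: shifted_coef_lead => //; apply/contE => //; exists P.
have key : ps`_i ^+ d * (a%:P * v * s) = (al * b)%:P * w * prod_pow ps ks.
  apply: (mulIf f'0); rewrite polyCM.
  have -> : ps`_i ^+ d * (a%:P * v * s) * f' = a%:P * (v * ps`_i ^+ d) * (s * f') by ring.
  rewrite -sE -[RHS]/(al%:P * b%:P * w * prod_pow ps ks * f').
  have -> : al%:P * b%:P * w * prod_pow ps ks * f' =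
    al%:P * w * (b%:P * prod_pow ps ks * f') by ring.
  rewrite -lead_L.
  have -> : a%:P * (v * ps`_i ^+ d) * (al%:P * g) = a%:P * al%:P * (v * ps`_i ^+ d * g) by ring.
  by rewrite gE; ring.
(* After cancelling p_i^(ks i) a factor p_i is left; it divides neither the constant, nor [w], nor
   the other primes. *)
have : dvdr ps`_i ((al * b)%:P * (w * \prod_(j < size ps | j != Ordinal lt_i) ps`_j ^+ ks j)).
  exists (ps`_i ^+ (d - ks i).-1 * (a%:P * v * s)).
  apply: (mulIf (x := ps`_i ^+ ks i)); first by rewrite expf_neq0.
  have pd : ps`_i ^+ d = ps`_i ^+ (d - ks i).-1 * ps`_i * ps`_i ^+ ks i.
    by rewrite -exprSr -exprD prednK ?subn_gt0 // subnK // ltnW.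
  transitivity (ps`_i ^+ d * (a%:P * v * s)); last by rewrite pd; ring.
  by rewrite key (prod_pow_split (Ordinal lt_i)) /=; ring.
have al_b0 : al * b != 0 by rewrite mulf_neq0.
move/pP=> [/(prime_const_dvd lt_i al_b0)//|/pP[pw|]].
  case/negP: pU; apply: (cop _ _ pw).
  by case: d lt_d {pd0 gE key cop} => // d _; rewrite exprSr; exists (ps`_i ^+ d).
move/(primeR_prod p_prime) => [j ji /(primeR_exp p_prime) pj].
have ij : i <> j by move=> ij; case/eqP: ji; apply: val_inj.
by case/negP: pU; apply: (ps_coprime lt_i (ltn_ord j) ij) => //; apply: dvdr_refl.
Qed.

(** [lead_L] solved for [f'] shows that [F] removes all the p_j^(ks j) at once. *)
Lemma exponent_removable i : (i < size ps)%N ->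
  removable sigma sigmainv delta (ps`_i ^+ ks i) L k.
Proof.
move=> lt_i; have [p0 pU _] := ps_prime lt_i.
split.
  rewrite L_fact (prod_pow_split (Ordinal lt_i)) /= -(subnK (le_ks i)) exprD.
  by apply/dvdr_mull/dvdr_mulr/dvdr_mull/dvdr_refl.
case: (F_cont) => A AE.
have A0 : A != 0.
  apply: contraNneq F0 => A0; have : emb F = 0.
    by rewrite -AE A0 /ore_mul size_poly0 big_ord0.
  by rewrite -(emb0 R) => /emb_inj->.
have sA : size A = k.+1.
  have sA : size A = (size A).-1.+1 by rewrite prednK // size_poly_gt0.
  have /eqP := size_ore_mul sigmaK deltaD deltaM L0 sA AE.
  by rewrite size_F eqSS eqn_add2r => /eqP->.
(* The other primes go into the denominator [v], so the numerator [w] is the constant [a]. *)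
exists A, a%:P, (b%:P * \prod_(j < size ps | j != Ordinal lt_i) ps`_j ^+ ks j), F.
have v0 : b%:P * \prod_(j < size ps | j != Ordinal lt_i) ps`_j ^+ ks j != 0.
  rewrite mulf_neq0 ?polyC_eq0 //; apply/prodf_neq0 => j _; rewrite expf_neq0 //.
  by case: (ps_prime (ltn_ord j)).
split=> //; split; last first.
  split=> //; split=> //; rewrite (sigZN sigmaK sigmainvK) -tofracM tofrac_div_eq.
    rewrite lead_F -/f' lead_L (prod_pow_split (Ordinal lt_i)) /=; ring.
  by rewrite mulf_neq0 // expf_neq0.
(* A divisor of [a] is constant, and a constant dividing a power of a primitive polynomial is a
   unit. *)
move=> d dp [q aE].
have q0 : q != 0 by apply: contraNneq a0 => q0; rewrite -polyC_eq0 aE q0 mul0r.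
have d0 : d != 0 by apply: contraNneq a0 => d0; rewrite -polyC_eq0 aE d0 mulr0.
have /size_poly1P[x x0 dE] : size d == 1%N.
  have := congr1 (fun s : {poly R} => size s) aE.
  rewrite /= size_mul // size_polyC a0; move: q0 d0; rewrite -!size_poly_gt0.
  by case: (size q) => // s _; case: (size d) => [|[|t]] // _; rewrite addSn !addnS.
rewrite dE in dp *; rewrite poly_unitE size_polyC x0 coefC /=.
have [irr sp] := ps_irr lt_i.
exact: unimodular_exp_gauss (irreducible_unimodular hPID irr sp) dp.
Qed.

Lemma F_desingularized : desingularized sigma sigmainv delta ps L F.
Proof.
split=> //; split=> //; exists a, b, (mkseq ks (size ps)).
split=> //; split; first by rewrite size_mkseq.
have ksE i : (i < size ps)%N -> nth 0%N (mkseq ks (size ps)) i = ks i.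
  exact: nth_mkseq.
split=> [|i lt_i d]; last by rewrite ksE //; apply: over_exponent_non_removable.
have -> : (ordr L)%:Z - (ordr F)%:Z = - k%:Z.
  by rewrite [ordr F]/ordr size_F /= PoszD opprD addrC subrK.
have -> : \prod_(i < size ps) ps`_i ^+ nth 0%N (mkseq ks (size ps)) i = prod_pow ps ks.
  by apply: eq_bigr => i _; rewrite ksE.
rewrite (sigZN sigmaK sigmainvK) -tofracM tofrac_div_eq; first by rewrite lead_F lead_L.
by rewrite mulf_neq0 ?polyC_eq0 // prod_pow_neq0.
Qed.

(** Once the shifted leading coefficient [t] of [T] has degree at most deg f, it corresponds to a
    multiple of [f] in I_l; divisibility by [x] passes back through [sigma], which fixes
    constants. *)
Lemma desingularized_content_dvd T (x : R) :
  desingularized sigma sigmainv delta ps L T ->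
  dvdr x%:P f -> dvdr x%:P (lead_coef T).
Proof.
move=> [cT [T0 [a' [b' [ks' [b'0 [_ [E nonrem]]]]]]]] xf.
have [kT sT] := cont_size T0 cT.
move: E; have -> : (ordr L)%:Z - (ordr T)%:Z = - kT%:Z.
  by rewrite [ordr T]/ordr sT /= PoszD opprD addrC subrK.
rewrite (sigZN sigmaK sigmainvK) -tofracM tofrac_div_eq; last first.
  by rewrite mulf_neq0 ?polyC_eq0 // (prod_pow_neq0 ps_prime (nth 0%N ks')).
rewrite -/(prod_pow ps (nth 0%N ks')).
set t := iter kT sigmainv _ => E.
have tJ : shifted_coef t by apply: shifted_coef_lead => //; apply/contE.
have t0 : t != 0.
  by rewrite -size_poly_gt0 size_iter_sigmainv size_poly_gt0 lead_coef_eq0.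
(* Otherwise p_i^(ks i) would be non-removable by the condition on [T], whereas [F] removes it. *)
have ge_ks i : (i < size ps)%N -> (ks i <= nth 0%N ks' i)%N.
  move=> lt_i; rewrite leqNgt; apply/negP => lt_k.
  exact: (nonrem _ lt_i _ lt_k k (exponent_removable lt_i)).
have st : (size t <= size f)%N.
  pose D := prod_pow ps (fun i => nth 0%N ks' i - ks i)%N.
  have D0 : D != 0 by apply: prod_pow_neq0.
  have DE : prod_pow ps (nth 0%N ks') = prod_pow ps ks * D.
    rewrite -prod_powD; apply: eq_bigr => i _; by rewrite subnKC // ge_ks.
  (* Comparing the factorizations given by [T] and [F]: up to nonzero constants, [f'] is [D * t]. *)
  have key : (a * b')%:P * (D * t) = (a' * b)%:P * f'.
    apply: (mulfI (prod_pow_neq0 ps_prime ks)); rewrite !polyCM.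
    have -> : prod_pow ps ks * (a'%:P * b%:P * f') =
      a'%:P * (b%:P * prod_pow ps ks * f') by ring.
    by rewrite -lead_L [a'%:P * (_ * _)]mulrCA -E DE; ring.
  have Dt0 : D * t != 0 by rewrite mulf_neq0.
  have ab'0 : a * b' != 0 by rewrite mulf_neq0.
  have a'b0 : a' * b != 0.
    apply: contraNneq Dt0 => a'b0; move/eqP: key.
    by rewrite a'b0 mul0r mulf_eq0 polyC_eq0 (negPf ab'0).
  have := congr1 (fun s : {poly R} => size s) key.
  rewrite /= !mul_polyC !size_scale // size_f' size_mul // => <-.
  by move: D0; rewrite -size_poly_gt0; case: (size D) => // s _; rewrite leq_addl.
have [i [j [h [hI hE sh]]]] := shifted_coef_Ik tJ.
have fh : dvdr f h by apply: Ik_min_multiple => //; rewrite sh.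
have -> : lead_coef T = iter kT sigma t by rewrite iter_sigmainvK.
apply/dvdrC_iter_sigma/(dvdrC_iter_sigma _ i); rewrite hE.
by apply/dvdrC_iter_sigma; apply: dvdr_trans fh.
Qed.

End Desingularization.

Theorem mainTheorem3
  (R : idomainType) (hPID : PID R)
  (gamma tau : R) (hgamma : gamma \is a GRing.unit)
  (sigma : {rmorphism {poly R} -> {poly R}})
  (hsigmaR : forall c : R, sigma c%:P = c%:P)
  (hsigmaX : sigma 'X = gamma%:P * 'X + tau%:P)
  (sigmainv : {poly R} -> {poly R})
  (hsinv1 : cancel sigma sigmainv) (hsinv2 : cancel sigmainv sigma)
  (delta : {poly R} -> {poly R})
  (hdeltaD : forall p q, delta (p + q) = delta p + delta q)
  (hdeltaR : forall (c : R) p, delta (c%:P * p) = c%:P * delta p)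
  (hdeltaM : forall p q, delta (p * q) = sigma p * delta q + delta p * q)
  (hdeltaX : (size (delta 'X) <= 2)%N)
  (L : {poly {poly R}}) (hr : (0 < ordr L)%N)
  (c : R) (ps : seq {poly R}) (es : seq nat)
  (hfact : lead_coef L = c%:P * \prod_(i < size ps) ps`_i ^+ nth 0%N es i)
  (hes : size es = size ps)
  (hirr : forall i, (i < size ps)%N -> irreducibleR ps`_i /\ (1 < size (nth 0%R ps i))%N)
  (hcop : forall i j, (i < size ps)%N -> (j < size ps)%N -> i <> j ->
            coprimeR ps`_i ps`_j)
  (l : nat) (hgen : Mk_generates sigma delta L l)
  (G : seq {poly R}) (hG : reduced_GB (Ik sigma delta L l) G)
  (f : {poly R}) (hf : f \in G) (hfmin : forall g, g \in G -> (size f <= size g)%N)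
  (F : {poly {poly R}}) (hF : cont sigma delta L F) (hlc : lead_coef F = f) :
  completely_desingularized sigma sigmainv delta ps L F.
Proof.
have F0 : F != 0.
  by case: hG => -[gG _] _; case: (gG _ hf); rewrite -hlc lead_coef_eq0.
have [k sF] := cont_size hsinv1 hdeltaD hdeltaM hr F0 hF.
have [a [b [ks [a0 b0 le_ks E]]]] := lead_factorization hPID hgamma hsigmaR
  hsigmaX hsinv1 hsinv2 hdeltaD hdeltaM hr hgen hG hf hfmin hF hlc sF
  (e := nth 0%N es) hfact hirr.
split.
  exact: (F_desingularized hPID hgamma hsigmaR hsigmaX hsinv1 hsinv2 hdeltaD
    hdeltaM hr hgen hG hf hfmin hF hlc sF hirr hcop b0 E).
(* [cT] is a greatest common divisor of the coefficients of lc(T), so it suffices that [cQ], a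
   constant dividing [f], divides each of them. *)
move=> T hT cQ cT [cQ_dvd _] [_ cT_max]; apply: cT_max => i.
have [|q ->] := desingularized_content_dvd hPID hgamma hsigmaR hsigmaX hsinv1
  hsinv2 hdeltaD hdeltaM hr hgen hG hf hfmin hF hlc sF (e := nth 0%N es) hfact
  hirr a0 b0 le_ks E (x := cQ) hT.
  by apply: coef_dvdr_polyC => j; rewrite -hlc.
by exists q`_i; rewrite coefMC.
Qed.
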